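(* Let $R$ be a finite commutative ring with $1\neq 0$ such that $\gamma_a(\Gamma(R))=2$. Then $\Gamma(R)$ is partitionable into global defensive alliances if and only if either $\psi_g(\Gamma(R))=2$ or $R\cong \mathbb{F}_4\times \mathbb{F}_4$.
   Context: $\mathbb{F}_4$ denotes the field with $4$ elements. For a commutative ring $R$ with $1\neq 0$, the zero-divisor graph $\Gamma(R)$ is the simple graph whose vertices are the nonzero zero-divisors of $R$, two distinct vertices $x,y$ being adjacent if and only if $xy=0$. Let $\Gamma=(V,E)$ be a finite simple graph. For $S\subseteq V$ put $\bar S=V\setminus S$ and $\deg_S(x)=|S\cap N(x)|$, where $N(x)$ is the set of vertices adjacent to $x$. A nonempty $S\subseteq V$ is a dominating set if $\deg_S(v)>0$ for every $v\in\bar S$; it is a defensive alliance if $\deg_S(x)+1\ge \deg_{\bar S}(x)$ for every $x\in S$; it is a global defensive alliance if it is both. The global defensive alliance partition number $\psi_g(\Gamma)$ is the maximum number of sets in a partition of $V$ such that each set is a global defensive alliance; $\Gamma$ is partitionable into global defensive alliances if $\psi_g(\Gamma)\ge 2$. The global defensive alliance number $\gamma_a(\Gamma)$ is the minimum cardinality of a global defensive alliance in $\Gamma$. *)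

(* Defs.v *)
From HB Require Import structures.
From mathcomp Require Import all_boot all_order all_fingroup all_algebra all_field.

Set Implicit Arguments.
Unset Strict Implicit.
Unset Printing Implicit Defensive.

Import GRing.Theory.

Record sgraph := SGraph {
  vertex :> finType;
  adj : rel vertex;
  adj_sym : symmetric adj;
  adj_irr : irreflexive adj }.

Section Alliances.
Variable G : sgraph.
Implicit Types (S : {set G}) (P : {set {set G}}) (x v : G).

Definition nbhd x : {set G} := [set y | adj x y].

Definition deg_in S x : nat := #|S :&: nbhd x|.

Definition dominating S : bool :=
  (S != set0) && [forall v in ~: S, 0 < deg_in S v].

Definition defensive_alliance S : bool :=
  (S != set0) && [forall x in S, deg_in (~: S) x <= deg_in S x + 1].

Definition global_defensive_alliance S : bool :=
  dominating S && defensive_alliance S.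

Definition gda_partition P : bool :=
  partition P [set: G] && [forall S in P, global_defensive_alliance S].

Definition psi_g : nat := \max_(P : {set {set G}} | gda_partition P) #|P|.

Definition gda_partitionable : Prop := 2 <= psi_g.

(* The unit #|G| of the minimum does not affect the value: when G is nonempty
   [set: G] is itself a global defensive alliance.  When G is empty there is
   no alliance at all and gamma_a is 0 by convention. *)
Definition gamma_a : nat :=
  \big[minn/#|G|]_(S : {set G} | global_defensive_alliance S) #|S|.

End Alliances.

Section ZeroDivisorGraph.
Variable R : finComNzRingType.
Local Open Scope ring_scope.

Definition zero_divisor (x : R) : bool :=
  [exists y : R, (y != 0) && (x * y == 0)].

Definition nonzero_zero_divisor (x : R) : bool := (x != 0) && zero_divisor x.

Definition zd_vertex : finType := {x : R | nonzero_zero_divisor x}.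

Definition zd_adj : rel zd_vertex :=
  fun x y => (x != y) && (val x * val y == 0).

Lemma zd_adj_sym : symmetric zd_adj.
Proof. by move=> x y; rewrite /zd_adj eq_sym mulrC. Qed.

Lemma zd_adj_irr : irreflexive zd_adj.
Proof. by move=> x; rewrite /zd_adj eqxx. Qed.

Definition zero_divisor_graph : sgraph := SGraph zd_adj_sym zd_adj_irr.

End ZeroDivisorGraph.

Definition ring_isomorphic (R S : nzRingType) : Prop :=
  exists f : {rmorphism R -> S}, bijective f.

Definition F4 : finFieldType := s2val (pPrimePowerField (isT : prime 2) (isT : 0 < 2)).

Lemma card_F4 : #|F4| = 4.
Proof. exact: (s2valP' (pPrimePowerField (isT : prime 2) (isT : 0 < 2))). Qed.

(* Main.v *)
(** If the partition has at least three parts, then, since every alliance has at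
    least two elements, there are at least six vertices; but an alliance [{x, y}]
    dominates at most four further vertices.  So equality holds throughout: [x]
    and [y] are adjacent, have two other neighbours each, and every vertex is a
    neighbour of exactly one of them.  In the zero-divisor graph, counting shows
    that [x^2] and [y^2] are nonzero, so [I = Ann x] and [J = Ann y] have four
    elements, meet in [0], and cover all zero-divisors.  Multiplication by [x] is
    injective on [J], hence permutes it, which yields an idempotent [f] with
    [x = x f], [f] in [J] and [1 - f] in [I].  Thus [R = I * J] as rings, and a
    zero-divisor inside a factor would give one outside the union of [I] and [J];
    both factors are therefore fields with four elements. *)
From HB Require Import structures.
Require Import Defs.
From mathcomp Require Import all_boot all_order all_fingroup all_algebra all_field.

Set Implicit Arguments.
Unset Strict Implicit.
Unset Printing Implicit Defensive.

Import GRing.Theory.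

(** * Alliances of two vertices in a finite graph *)

Section Graph.
Variable G : sgraph.
Implicit Types (S : {set G}) (P : {set {set G}}) (x y v : G).

(* The graph has six vertices: [x], [y] and two private neighbours of each. *)
Definition double_star_edge x y : bool :=
  [&& adj x y, #|nbhd x| == 3, #|nbhd y| == 3,
      nbhd x :&: nbhd y == set0 & nbhd x :|: nbhd y == setT].

Lemma gamma_a_le S : global_defensive_alliance S -> gamma_a G <= #|S|.
Proof.
rewrite /gamma_a => gS; have : S \in index_enum {set G} by rewrite mem_index_enum.
elim: (index_enum _) => // T r IHr; rewrite inE big_cons => /predU1P[<-|/IHr le_r].
  by rewrite gS geq_minl.
by case: ifP => // _; rewrite geq_min le_r orbT.
Qed.

(** The strict bound excludes the default value [#|G|] of the minimum, the only value that need not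
    come from an alliance. *)
Lemma gamma_a_attained : gamma_a G < #|G| ->
  exists2 S : {set G}, global_defensive_alliance S & #|S| = gamma_a G.
Proof.
rewrite /gamma_a.
elim/big_rec: _ => [|T m gT IHm]; first by rewrite ltnn.
rewrite /minn; case: ifP => // _ _; by exists T.
Qed.

Lemma large_psi_g_double_star_edge : gamma_a G = 2 -> 2 < psi_g G ->
  exists x y, double_star_edge x y.
Proof.
move=> gam2 psi3.
have [P /andP[partP /forall_inP gdaP] P3] :
    exists2 P : {set {set G}}, gda_partition P & 2 < #|P|.
  have [/exists_inP//|/exists_inPn noP] :=
    boolP [exists P in [pred P : {set {set G}} | gda_partition P], 2 < #|P|].
  suff : psi_g G <= 2 by rewrite leqNgt psi3.
  by apply/bigmax_leqP => Q gQ; rewrite leqNgt noP.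
have G6 : 6 <= #|G|.
  rewrite -cardsT (card_partition partP).
  have : \sum_(S in P) 2 <= \sum_(S in P) #|S|.
    by apply: leq_sum => S /gdaP /gamma_a_le; rewrite gam2.
  by apply: leq_trans; rewrite sum_nat_const; apply: (@leq_mul 3 2).
have gam_lt : gamma_a G < #|G| by rewrite gam2 (leq_trans _ G6).
have [S /andP[/andP[_ /forall_inP domS] /andP[_ /forall_inP defS]]] :=
  gamma_a_attained gam_lt.
rewrite gam2 => /eqP/cards2P[x [y [neq_xy defS2]]]; exists x, y.
have xS : x \in S by rewrite defS2 !inE eqxx.
have yS : y \in S by rewrite defS2 !inE eqxx orbT.
have S2 : #|S| = 2 by rewrite defS2 cards2 neq_xy.
have SC : ~: S \subset (~: S :&: nbhd x) :|: (~: S :&: nbhd y).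
  apply/subsetP => v vS; rewrite -setIUr inE vS /=.
  have := domS v vS; rewrite card_gt0 => /set0Pn[z]; rewrite defS2 !inE.
  by case/andP => /pred2P[]->; rewrite adj_sym => ->; rewrite ?orbT.
have inx : S :&: nbhd x = if adj x y then [set y] else set0.
  apply/setP => z; rewrite defS2 !inE.
  case: (z =P x) => [->|_]; last case: (z =P y) => [->|/eqP/negPf zy] /=.
  - by rewrite adj_irr andbF; case: ifP; rewrite !inE ?(negPf neq_xy).
  - by case: ifP; rewrite !inE ?eqxx.
  - by case: ifP; rewrite !inE.
have iny : S :&: nbhd y = if adj x y then [set x] else set0.
  apply/setP => z; rewrite defS2 !inE orbC.
  case: (z =P y) => [->|_]; last case: (z =P x) => [->|/eqP/negPf zy] /=.
  - by rewrite adj_irr andbF; case: ifP; rewrite !inE ?(eq_sym y) ?(negPf neq_xy).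
  - by rewrite adj_sym; case: ifP; rewrite !inE ?eqxx.
  - by case: ifP; rewrite !inE.
have := defS x xS; have := defS y yS; rewrite /deg_in inx iny.
have cC : 4 <= #|~: S| by rewrite cardsCs setCK S2 leq_subRL // (leq_trans _ G6).
have := leq_trans cC (subset_leq_card SC).
have := cardsUI (~: S :&: nbhd x) (~: S :&: nbhd y).
set A := ~: S :&: nbhd x; set B := ~: S :&: nbhd y.
(* If [x] and [y] are not adjacent, the alliance condition allows each at most one outside
   neighbour, too few to dominate the four or more vertices of [~: S]. If they are adjacent, it
   allows each two. *)
case: ifP => [xy|_]; rewrite ?cards1 ?cards0 => UI U4 By Ax; last first.
  have U4I := leq_trans U4 (leq_addr #|A :&: B| _).
  by move: U4I; rewrite UI => /leq_trans/(_ (leq_add Ax By)).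
have AB4 : #|A| + #|B| <= 4 by apply: leq_add Ax By.
have [A2 B2] : #|A| = 2 /\ #|B| = 2.
  have : 4 <= #|A| + #|B| by rewrite -UI (leq_trans U4) // leq_addr.
  by move: Ax By; case: #|A| => [|[|[|]]] //; case: #|B| => [|[|[|]]].
have AB0 : A :&: B = set0.
  apply/eqP; rewrite -cards_eq0 -leqn0 -(leq_add2l 4).
  by apply: leq_trans (leq_add U4 (leqnn _)) _; rewrite UI A2 B2.
have cardN z T : S :&: nbhd z = T -> #|T| + #|~: S :&: nbhd z| = #|nbhd z|.
  by move=> <-; rewrite -(cardsID S (nbhd z)) setDE ![nbhd z :&: _]setIC.
rewrite /double_star_edge xy -(cardN x _ inx) -(cardN y _ iny) -/A -/B.
rewrite A2 B2 xy !cards1 /=.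
apply/andP; split.
  rewrite -subset0; apply/subsetP => z /setIP[zx zy].
  have [zS|zS] := boolP (z \in S).
    have : z \in S :&: nbhd y by rewrite inE zS.
    have : z \in S :&: nbhd x by rewrite inE zS.
    by rewrite inx iny xy !inE => /eqP->; rewrite eq_sym (negPf neq_xy).
  by move: zx zy; rewrite -AB0 !inE zS => -> ->.
rewrite -subTset; apply/subsetP => z _; rewrite !inE.
have [zS|zS] := boolP (z \in S).
  by move: zS; rewrite defS2 !inE => /pred2P[]->; rewrite ?xy // adj_sym xy ?orbT.
have : z \in ~: S by rewrite inE.
by move/(subsetP SC); rewrite !inE zS.
Qed.

(** The parts are [[set x; y]] and its complement. Each of [x], [y] has one neighbour inside the
    pair and two outside; every other vertex has exactly one neighbour in the pair, which an
    alliance tolerates. *)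
Lemma double_star_edge_partitionable x y :
  double_star_edge x y -> gda_partitionable G.
Proof.
case/and5P => xy /eqP Nx3 /eqP Ny3 /eqP NI /eqP NU.
have neq_xy : x != y by apply: contraTneq xy => ->; rewrite adj_irr.
set S := [set x; y].
have notboth v : adj x v -> adj y v -> False.
  by move=> xv yv; have := in_set0 v; rewrite -NI !inE xv yv.
have either v : adj x v || adj y v by have := in_setT v; rewrite -NU !inE.
have edge v w : v \in S -> w \in S -> v != w -> adj v w.
  by rewrite !inE => /pred2P[]-> /pred2P[]->; rewrite ?eqxx // adj_sym.
have N3 v : v \in S -> #|nbhd v| = 3 by case/set2P => ->.
have mate v : v \in S -> exists2 w, w \in S & v != w.
  by case/set2P => ->; [exists y | exists x]; rewrite ?set21 ?set22 // eq_sym.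
have inS v : v \in S -> 0 < #|S :&: nbhd v|.
  move=> vS; have [w wS vw] := mate v vS.
  by apply/card_gt0P; exists w; rewrite inE wS inE edge.
have inS1 v : #|S :&: nbhd v| <= 1.
  rewrite leqNgt; apply/negP => /card_gt1P[a [b [/setIP[aS +] /setIP[bS +]]]].
  rewrite !inE => va vb ab; move: aS bS ab; rewrite !inE.
  by case/pred2P => ea /pred2P[] eb; rewrite ea eb ?eqxx // => _;
    apply: (notboth v); rewrite adj_sym -?ea -?eb.
have split3 v : v \in S -> #|~: S :&: nbhd v| = 2.
  move=> vS; have := N3 v vS.
  rewrite -(cardsID S (nbhd v)) setDE ![nbhd v :&: _]setIC.
  have /eqP -> : #|S :&: nbhd v| == 1 by rewrite eqn_leq inS1 inS.
  by case.
have xS : x \in S := set21 _ _.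
have S0 : S != set0 by apply/set0Pn; exists x.
have C0 : ~: S != set0.
  by apply: contra_eq_neq (split3 x xS) => ->; rewrite set0I cards0.
have gS : global_defensive_alliance S.
  rewrite /global_defensive_alliance /dominating /defensive_alliance S0 /=.
  apply/andP; split; apply/forall_inP => v vS.
    rewrite card_gt0; apply/set0Pn; case/orP: (either v) => av.
      by exists x; rewrite inE set21 inE adj_sym.
    by exists y; rewrite inE set22 inE adj_sym.
  by rewrite /deg_in split3 // addn1 ltnS inS.
have gC : global_defensive_alliance (~: S).
  rewrite /global_defensive_alliance /dominating /defensive_alliance C0 /=.
  rewrite setCK; apply/andP; split; apply/forall_inP => v vS.
    by rewrite /deg_in split3.
  by rewrite /deg_in (leq_trans (inS1 v)) // addn1.
have neqSC : S != ~: S by apply/eqP => /setP/(_ x); rewrite in_setC xS.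
apply: leq_trans (_ : #|[set S; ~: S]| <= _); first by rewrite cards2 neqSC.
apply: (@leq_bigmax_cond _ (@gda_partition G) (fun P => #|P|)).
apply/andP; split; last by apply/forall_inP => T /set2P[]->.
apply/and3P; split.
- by rewrite /cover bigcup_setU !big_set1 setUCr.
- apply/trivIsetP => A B /set2P[]-> /set2P[]->; rewrite ?eqxx // => _;
    by rewrite -setI_eq0 ?setICr // setIC setICr.
- by rewrite !inE ![set0 == _]eq_sym negb_or S0.
Qed.

End Graph.

(** * Fields with four elements, possibly without the unit of the ambient ring *)

Section CardFour.
Local Open Scope ring_scope.

(** Translation by [a] permutes [A], so comparing the sum over [A] before and after it leaves
    [a *+ #|A|] equal to zero. This is Lagrange's theorem with no subgroup structure on [A]. *)
Lemma mulrn_card_closed (V : finZmodType) (A : {set V}) a :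
  (forall z, z \in A -> a + z \in A) -> a *+ #|A| = 0.
Proof.
move=> closA.
have imA : [set a + z | z in A] = A.
  apply/eqP; rewrite eqEcard (card_imset _ (addrI a)) leqnn andbT.
  by apply/subsetP => _ /imsetP[z zA ->]; apply: closA.
apply: (@addIr _ (\sum_(z in A) z)); rewrite add0r -[in RHS]imA.
by rewrite big_imset /= ?big_split ?sumr_const //; move=> ? ? _ _; apply: addrI.
Qed.

(* [e] plays the role of [1] and [u] that of a primitive cube root of unity. *)
Definition F4_frame (T : comNzRingType) (e u : T) : Prop :=
  [/\ e + e = 0, e * e = e, e * u = u & u * u = u + e] /\
  [/\ e != 0, u != 0 & u != e].

Lemma F4_frame_card4_domain (T : finComNzRingType) (J : {set T}) (e : T) :
  #|J| = 4%N -> {in J &, forall i j, i + j \in J} ->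
  {in J &, forall i j, i * j \in J} ->
  e \in J -> e != 0 -> {in J, forall j, e * j = j} ->
  {in J &, forall i j, i * j = 0 -> i = 0 \/ j = 0} ->
  exists2 u, J = [set 0; e; u; u + e] & F4_frame e u.
Proof.
move=> J4 addJ mulJ eJ e0 eK domJ.
(* Characteristic two: [e + e] has square [e *+ 4], which is zero because [J] has four elements, and
   [J] has no zero-divisors. *)
have e4 : e + e + (e + e) = 0.
  have := @mulrn_card_closed _ J e (fun z => addJ e z eJ).
  by rewrite J4 => <-; rewrite -!mulr2n -mulrnA.
have eeJ : e + e \in J by apply: addJ.
have ee : e + e = 0.
  by have := domJ _ _ eeJ eeJ; rewrite mulrDl eK // e4 => /(_ erefl)[].
have J0 : 0 \in J by rewrite -ee.
have [u /setDP[uJ]] : exists u, u \in J :\: [set 0; e].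
  apply/set0Pn; rewrite -card_gt0 cardsD J4 (setIidPr _) ?cards2 1?eq_sym ?e0 //.
  by apply/subsetP => z /set2P[]->.
rewrite !inE negb_or => /andP[u0 ue].
have uu : u + u = 0 by rewrite -(eK u uJ) -mulrDl ee mul0r.
have u_e : u * e = u by rewrite mulrC eK.
have Ne : - e = e by apply: (addrI e); rewrite subrr.
have ue0 : u + e != 0 by rewrite -{1}Ne subr_eq0.
have uee : u + e != e by rewrite -subr_eq0 addrK.
have ueu : u + e != u by rewrite -subr_eq0 addrAC subrr add0r.
have ueJ : u + e \in J by apply: addJ.
have defJ : J = [set 0; e; u; u + e].
  apply/eqP; rewrite eq_sym eqEcard J4; apply/andP; split.
    apply/subsetP => z; rewrite !inE.
    by case/orP => [/orP[/orP[]|]|] /eqP->.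
  rewrite -!setUA !cardsU1 cards1 !inE ![0 == _]eq_sym !negb_or e0 u0 ue0.
  by rewrite ![e == _]eq_sym ue uee [u == _]eq_sym ueu.
exists u => //; split=> //; split=> //; [exact: eK | exact: eK |].
(* The values [0], [e] and [u] of [u * u] are excluded in turn: they make [u * u],
   [(u + e) * (u + e)] and [u * (u + e)] vanish. *)
have := mulJ _ _ uJ uJ; rewrite {1}defJ !inE => /orP[/orP[/orP[]|]|] /eqP // sqr.
- by case: (domJ u u) u0 => // ->; rewrite eqxx.
- case: (domJ (u + e) (u + e)) ue0 => // [|->|->]; rewrite ?eqxx //.
  by rewrite mulrDl !mulrDr u_e !eK // sqr -addrA (addrA u) uu add0r ee.
- case: (domJ u (u + e)) => // [||ue_0].
  + by rewrite mulrDr u_e sqr.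
  + by move=> u_0; rewrite u_0 eqxx in u0.
  + by rewrite ue_0 eqxx in ue0.
Qed.

(** Bundled as rewrite rules, so that sums and products of nonzero frame elements are evaluated by
    one [rewrite], with [u + e] as normal form. *)
Lemma F4_frame_add_mul (T : comNzRingType) (e u : T) : F4_frame e u ->
  ((e + e = 0)%R * (u + u = 0)%R * (e + u = u + e)%R * (e + (u + e) = u)%R *
   (u + (u + e) = e)%R * (u + e + e = u)%R * (u + e + u = e)%R *
   (u + e + (u + e) = 0)%R *
   ((e * e = e)%R * (e * u = u)%R * (u * e = u)%R * (u * u = u + e)%R *
    (e * (u + e) = u + e)%R * ((u + e) * e = u + e)%R * (u * (u + e) = e)%R *
    ((u + e) * u = e)%R * ((u + e) * (u + e) = u)%R))%type.
Proof.
case=> [[ee e1 eu u2] _].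
have uu : u + u = 0 by rewrite -eu -mulrDl ee mul0r.
have ue : u * e = u by rewrite mulrC.
have s1 : u + (u + e) = e by rewrite addrA uu add0r.
have s2 : u + e + e = u by rewrite -addrA ee addr0.
have s3 : u + e + u = e by rewrite addrC s1.
do !split=> //.
- by rewrite addrC.
- by rewrite addrC s2.
- by rewrite addrA s3 ee.
- by rewrite mulrDr eu e1.
- by rewrite mulrDl ue e1.
- by rewrite mulrDr u2 ue s3.
- by rewrite mulrDl u2 eu s3.
- by rewrite mulrDl mulrDr u2 ue s3 mulrDr eu e1 addrC s2.
Qed.

(** Two frames have the same tables, so matching their elements respects both operations. Since [1]
    goes to [e], which may differ from [1] in [T], the map is left as a bare function. *)
Lemma F4_frame_map (K T : comNzRingType) (e u : T) (w : K) :
  (forall z : K, [\/ z = 0, z = 1, z = w | z = w + 1]) ->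
  F4_frame 1 w -> F4_frame e u ->
  exists g : K -> T,
    [/\ {morph g : y z / y + z}, {morph g : y z / y * z}, g 1 = e, injective g
      & forall t, t \in [:: 0; e; u; u + e] <-> exists z, g z = t].
Proof.
move=> allK frK frT.
have [_ [_ w0 w1]] := frK; have [_ [e0 u0 ue]] := frT.
have tK := F4_frame_add_mul frK; have tT := F4_frame_add_mul frT.
have w10 : w + 1 != 0.
  by apply: contra_neq w1 => /(congr1 (+%R^~ 1)); rewrite tK add0r.
have w11 : w + 1 != 1 by rewrite -subr_eq0 addrK.
have w1w : w + 1 != w by rewrite -subr_eq0 addrAC subrr add0r oner_neq0.
have ue0 : u + e != 0.
  by apply: contra_neq ue => /(congr1 (+%R^~ e)); rewrite tT add0r.
have uee : u + e != e by rewrite -subr_eq0 addrK.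
have ueu : u + e != u by rewrite -subr_eq0 addrAC subrr add0r.
pose g z := if z == 0 then 0 else if z == 1 then e else if z == w then u else u + e.
have g0 : g 0 = 0 by rewrite /g eqxx.
have g1 : g 1 = e by rewrite /g oner_eq0 eqxx.
have gw : g w = u by rewrite /g (negPf w0) (negPf w1) eqxx.
have gw1 : g (w + 1) = u + e by rewrite /g (negPf w10) (negPf w11) (negPf w1w).
have gE := (g0, g1, gw, gw1).
have neqF (a b : T) : a != b -> ((a == b = false) * (b == a = false))%type.
  by rewrite [b == a]eq_sym => /negPf->.
have neqs := (neqF _ _ e0, neqF _ _ u0, neqF _ _ ue, neqF _ _ ue0,
  neqF _ _ uee, neqF _ _ ueu).
exists g; split=> //.
- by move=> y z; case: (allK y) => ->; case: (allK z) => ->;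
    rewrite ?addr0 ?add0r ?tK !gE ?addr0 ?add0r ?tT.
- by move=> y z; case: (allK y) => ->; case: (allK z) => ->;
    rewrite ?mulr0 ?mul0r ?tK !gE ?mulr0 ?mul0r ?tT.
- by move=> y z; case: (allK y) => ->; case: (allK z) => ->;
    rewrite !gE // => /eqP; rewrite ?neqs.
- move=> t; rewrite !inE; split=> [|[z <-]].
    by case/or4P => /eqP->; [exists 0 | exists 1 | exists w | exists (w + 1)].
  by case: (allK z) => ->; rewrite gE eqxx ?orbT.
Qed.

Lemma card4_field_frame (K : finFieldType) : #|K| = 4%N ->
  exists2 w : K, F4_frame 1 w & forall z, [\/ z = 0, z = 1, z = w | z = w + 1].
Proof.
move=> K4.
have [|||||||w defT frw] := @F4_frame_card4_domain K setT 1.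
- by rewrite cardsT.
- by move=> y z _ _; rewrite inE.
- by move=> y z _ _; rewrite inE.
- by rewrite inE.
- exact: oner_neq0.
- by move=> z _; rewrite mul1r.
- by move=> y z _ _ /eqP; rewrite mulf_eq0 => /orP[]/eqP; [left | right].
exists w => // z; have := in_setT z; rewrite defT !inE.
by case/orP => [/orP[/orP[]|]|] /eqP->; constructor.
Qed.

Lemma bijective_ring_isomorphic (R S : nzRingType) (f : R -> S) :
  bijective f -> {morph f : x y / x + y} -> {morph f : x y / x * y} -> f 1 = 1 ->
  ring_isomorphic R S.
Proof.
move=> bijf fD fM f1.
have f0 : f 0 = 0 by apply: (addrI (f 0)); rewrite -fD !addr0.
have fB : {morph f : x y / x - y}.
  by move=> x y; apply: (@addIr _ (f y)); rewrite -fD !subrK.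
pose fZ := GRing.isZmodMorphism.Build R S f fB.
pose fX := GRing.isMonoidMorphism.Build R S f (f1, fM).
pose F : {rmorphism R -> S} := HB.pack f fZ fX.
by exists F.
Qed.

(** The orthogonal idempotents [e] and [f] split [R] into two ideals, each a copy of [K]. Adding the
    two embeddings gives a bijection from [K * K], whose inverse is the isomorphism. *)
Lemma F4_frames_ring_isomorphic (K : finFieldType) (R : finComNzRingType)
    (e u f v : R) :
  #|K| = 4%N -> F4_frame e u -> F4_frame f v -> e * f = 0 -> e + f = 1 ->
  (forall r, r * e \in [:: 0; e; u; u + e]) ->
  (forall r, r * f \in [:: 0; f; v; v + f]) ->
  ring_isomorphic R (K * K)%type.
Proof.
move=> K4 fre frf ef0 ef1 eR fR.
have [w frK allK] := card4_field_frame K4.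
have [g [gD gM g1 gI gS]] := F4_frame_map allK frK fre.
have [h [hD hM h1 hI hS]] := F4_frame_map allK frK frf.
have ge z : e * g z = g z by rewrite -g1 -gM mul1r.
have hf z : f * h z = h z by rewrite -h1 -hM mul1r.
have eh z : e * h z = 0 by rewrite -hf mulrA ef0 mul0r.
have fg z : f * g z = 0 by rewrite -ge mulrA (mulrC f) ef0 mul0r.
have gh y z : g y * h z = 0 by rewrite -ge -mulrA mulrCA eh mulr0.
pose phi (p : K * K) := g p.1 + h p.2.
have phiI : injective phi.
  move=> [a b] [a' b'] /= eq_phi; congr (_, _).
    apply: gI; have := congr1 ( *%R e) eq_phi.
    by rewrite /phi /= !mulrDr !ge !eh !addr0.
  apply: hI; have := congr1 ( *%R f) eq_phi.
  by rewrite /phi /= !mulrDr !hf !fg !add0r.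
(* Surjectivity is the decomposition of [r] as [r * e + r * f]. *)
have [psi psiK] : exists psi : R -> K * K, cancel psi phi.
  apply: (@fin_all_exists R (fun=> (K * K)%type) (fun r p => phi p = r)) => r.
  have /gS[a ga] := eR r; have /hS[b hb] := fR r.
  by exists (a, b); rewrite /phi /= ga hb -mulrDr ef1 mulr1.
have phiK : cancel phi psi by apply: inj_can_sym.
have phiD : {morph phi : p q / p + q}.
  by move=> p q; rewrite /phi gD hD addrACA.
have phiM : {morph phi : p q / p * q}.
  move=> p q; rewrite /phi gM hM mulrDl !mulrDr gh addr0.
  by rewrite [h _ * g _]mulrC gh add0r.
have phi1 : phi 1 = 1 by rewrite /phi g1 h1.
apply: (@bijective_ring_isomorphic _ _ psi); first by exists phi.
- by move=> r s; apply: phiI; rewrite phiD !psiK.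
- by move=> r s; apply: phiI; rewrite phiM !psiK.
- by apply: phiI; rewrite psiK phi1.
Qed.

End CardFour.

(** * Annihilators of the two ends of the edge, and the splitting of the ring *)

Section ZeroDivisors.
Local Open Scope ring_scope.
Variable R : finComNzRingType.
Implicit Types a b r : R.

(** The ring-theoretic form of [double_star_edge]. The conditions [r != a] and [r != b] reflect the
    absence of loops: the squares of [a] and [b] may a priori vanish. *)
Definition double_star_pair a b : Prop :=
  [/\ a != 0, b != 0, a != b & a * b = 0] /\
  [/\ #|[set r | [&& r != 0, r != a & a * r == 0]]| = 3%N,
      #|[set r | [&& r != 0, r != b & b * r == 0]]| = 3%N,
      forall r, r != 0 -> r != a -> r != b -> a * r = 0 -> b * r = 0 -> False &
      forall r, r != 0 -> zero_divisor r -> a * r = 0 \/ b * r = 0].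

Lemma double_star_pair_sym a b : double_star_pair a b -> double_star_pair b a.
Proof.
case=> [[a0 b0 ab ab0] [Na Nb notboth either]]; split.
  by split; rewrite // 1?eq_sym // mulrC.
split=> //; first by move=> r *; apply: (notboth r).
by move=> r r0 /(either r r0)[]; [right | left].
Qed.

(** If [a * a = 0], some element other than [0], [a], [b] is killed by both [a] and [b]: it is
    [a + b] or a further neighbour of [a] when [b * b = 0], and [a + a] otherwise. *)
Lemma double_star_pair_sqr a b : double_star_pair a b -> a * a != 0.
Proof.
case=> [[a0 b0 ab ab0] [Na Nb notboth either]]; apply/eqP => aa.
have [bb|bb] := eqVneq (b * b) 0.
  have [ab_0|ab_0] := eqVneq (a + b) 0; last first.
    apply: (notboth (a + b) ab_0);
      rewrite ?mulrDr ?aa ?ab0 ?bb ?[b * a]mulrC ?ab0 ?addr0 //.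
      by rewrite -subr_eq0 addrAC subrr add0r.
    by rewrite -subr_eq0 addrK.
  have bNa : b = - a by apply: (addrI a); rewrite subrr.
  have : [set r | [&& r != 0, r != a & a * r == 0]] :\ b != set0.
    apply: contra_eq_neq Na => N0.
    by rewrite (cardsD1 b) N0 cards0 addn0; case: (b \in _).
  case/set0Pn => r; rewrite !inE => /and4P[rb r0 ra /eqP ar].
  by apply: (notboth r); rewrite // bNa mulNr ar oppr0.
(* The annihilator of [a] consists of [0], [a] and the three neighbours of [a], and it is stable
   under adding [a]. As five is odd, [a + a] cannot vanish. *)
have a5 : a *+ 5 = 0.
  have <- : #|[set r | a * r == 0]| = 5%N.
    rewrite (cardsD1 0) (cardsD1 a) !inE mulr0 aa eqxx a0 /= -[in RHS]Na.
    by congr (_ + (_ + _))%N; apply: eq_card => r; rewrite !inE andbCA.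
  by apply: mulrn_card_closed => r; rewrite !inE mulrDr aa add0r.
have [aa0|aa_0] := eqVneq (a + a) 0.
  by move/eqP: a5; rewrite !mulrS mulr0n addr0 !addrA aa0 add0r aa0 add0r (negPf a0).
have aaa : a + a != a by rewrite -subr_eq0 addrK.
apply: (notboth (a + a)); rewrite ?mulrDr ?aa ?[b * a]mulrC ?ab0 ?addr0 //.
(* [a + a] differs from [b] because its square is zero. *)
apply: contraNneq bb => <-.
by rewrite mulrDl !mulrDr aa !addr0.
Qed.

(** Nonzero squares keep [a] and [b] out of their own annihilators. Hence that of [b] is its three
    neighbours and [0], and a nonzero common element would be a common neighbour. *)
Lemma double_star_pair_annihilators a b : double_star_pair a b ->
  [/\ #|[set r | b * r == 0]| = 4%N &
      forall r, a * r = 0 -> b * r = 0 -> r = 0].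
Proof.
move=> ds; have aa := double_star_pair_sqr ds.
have bb := double_star_pair_sqr (double_star_pair_sym ds).
case: ds => [[a0 b0 ab ab0] [Na Nb notboth either]]; split.
  rewrite (cardsD1 0) inE mulr0 eqxx -[in RHS]Nb; congr (_ + _)%N.
  apply: eq_card => r; rewrite !inE; case: (r =P b) => [->|//].
  by rewrite (negPf bb) !andbF.
move=> r ar br; have [//|r0] := eqVneq r 0; exfalso.
apply: (notboth r) => //.
  by apply: contraNneq aa => rE; rewrite -{2}rE ar.
by apply: contraNneq bb => rE; rewrite -{2}rE br.
Qed.

Lemma double_star_pair_frame a b : double_star_pair a b ->
  exists f, [/\ b * f = 0, a * (1 - f) = 0 &
    exists2 v, F4_frame f v & forall r, r * f \in [:: 0; f; v; v + f]].
Proof.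
move=> ds; have aa := double_star_pair_sqr ds.
have bb := double_star_pair_sqr (double_star_pair_sym ds).
have [J4 IJ0] := double_star_pair_annihilators ds.
case: ds => [[a0 b0 ab ab0] [Na Nb notboth either]].
set J := [set r | b * r == 0] in J4.
have inJ r : (r \in J) = (b * r == 0) by rewrite inE.
have ba0 : b * a = 0 by rewrite mulrC.
have aJ : a \in J by rewrite inJ ba0.
have mulJ r j : j \in J -> r * j \in J.
  by rewrite !inJ mulrCA => /eqP->; rewrite mulr0.
have ainj : {in J &, injective ( *%R a)}.
  move=> i j; rewrite !inJ => /eqP bi /eqP bj eq_aij; apply/eqP; rewrite -subr_eq0.
  by apply/eqP/IJ0; rewrite mulrBr ?eq_aij ?bi ?bj subrr.
have : a \in [set a * j | j in J].
  suff -> : [set a * j | j in J] = J by [].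
  apply/eqP; rewrite eqEcard card_in_imset // leqnn andbT.
  by apply/subsetP => _ /imsetP[j jJ ->]; apply: mulJ.
case/imsetP => f fJ af.
have bf : b * f = 0 by apply/eqP; rewrite -inJ.
have aNf : a * (1 - f) = 0 by rewrite mulrBr mulr1 -af subrr.
(* [f] is the unit of [J]: the element [(1 - f) * j] is killed by [a] through [1 - f] and by [b]
   through [j]. *)
have fK : {in J, forall j, f * j = j}.
  move=> j jJ; apply/eqP; rewrite eq_sym -subr_eq0 -{1}[j]mul1r -mulrBl.
  apply/eqP/IJ0; first by rewrite mulrA aNf mul0r.
  by move: jJ; rewrite inJ mulrCA => /eqP->; rewrite mulr0.
have f0 : f != 0 by apply: contraNneq a0 => f0; rewrite af f0 mulr0.
(* [j' + b] is a zero-divisor as soon as [j * j' = 0] with [j] in [J] nonzero,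
   and it lies in neither annihilator. *)
have domJ : {in J &, forall i j, i * j = 0 -> i = 0 \/ j = 0}.
  move=> i j; rewrite !inJ => /eqP bi /eqP bj ij.
  have [->|i0] := eqVneq i 0; [by left | right].
  have jb0 : j + b != 0.
    apply: contraNneq bb => jb0.
    by have := mulrDr b j b; rewrite jb0 bj mulr0 add0r => <-.
  have : zero_divisor (j + b).
    by apply/existsP; exists i; rewrite i0 mulrDl bi addr0 mulrC ij eqxx.
  case/(either _ jb0) => /eqP; rewrite mulrDr ?bj ?add0r ?(negPf bb) // ab0 addr0.
  by move=> /eqP aj; apply: IJ0.
have addJ : {in J &, forall i j, i + j \in J}.
  by move=> i j; rewrite !inJ mulrDr => /eqP-> /eqP->; rewrite addr0.
have mulJ2 : {in J &, forall i j, i * j \in J} by move=> i j _; apply: mulJ.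
have [v defJ frv] := F4_frame_card4_domain J4 addJ mulJ2 fJ f0 fK domJ.
exists f; split=> //; exists v => // r.
by have := mulJ r f fJ; rewrite defJ !inE -!orbA.
Qed.

Lemma double_star_pair_F4F4 (K : finFieldType) a b :
  #|K| = 4%N -> double_star_pair a b -> ring_isomorphic R (K * K)%type.
Proof.
move=> K4 ds; have [_ IJ0] := double_star_pair_annihilators ds.
have [f [bf af [v frv fR]]] := double_star_pair_frame ds.
have [e [ae be [u fru eR]]] := double_star_pair_frame (double_star_pair_sym ds).
(* [a] kills [e] and [1 - f], while [b] kills [f] and [1 - e]; so both kill [1 - e - f]. *)
have ef1 : e + f = 1.
  apply/esym/eqP; rewrite -subr_eq0 opprD addrA; apply/eqP/IJ0.
    by rewrite addrAC mulrBr af ae subrr.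
  by rewrite mulrBr be bf subrr.
apply: (F4_frames_ring_isomorphic K4 fru frv) => //.
by apply: IJ0; [rewrite mulrA ae mul0r | rewrite mulrCA bf mulr0].
Qed.

(** * Passage between the ring and its zero-divisor graph *)

Local Notation ZDG := (zero_divisor_graph R).

(** Neighbours can be counted in [R] itself: a nonzero element killed by the nonzero [val x] is
    automatically a vertex. *)
Lemma val_nbhd (x : ZDG) :
  val @: nbhd x = [set r | [&& r != 0, r != val x & val x * r == 0]].
Proof.
apply/setP => r; rewrite inE; apply/imsetP/idP => [[v]|/and3P[r0 rx xr]].
  rewrite inE => /andP[xv xv0] ->; have /andP[-> _] := valP v.
  by rewrite xv0 (inj_eq val_inj) eq_sym xv.
have zr : nonzero_zero_divisor r.
  rewrite /nonzero_zero_divisor r0; apply/existsP; exists (val x).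
  by have /andP[-> _] := valP x; rewrite mulrC.
exists (Sub r zr); last by rewrite SubK.
by rewrite inE /= /zd_adj SubK xr -(inj_eq val_inj) SubK eq_sym rx.
Qed.

Lemma card_nbhd (x : ZDG) :
  #|nbhd x| = #|[set r | [&& r != 0, r != val x & val x * r == 0]]|.
Proof. by rewrite -val_nbhd card_imset //; apply: val_inj. Qed.

Lemma double_star_edge_pair (x y : ZDG) :
  double_star_edge x y -> double_star_pair (val x) (val y).
Proof.
case/and5P => /andP[xy /eqP xy0] /eqP Nx /eqP Ny /eqP NI /eqP NU.
have /andP[x0 _] := valP x; have /andP[y0 _] := valP y.
split; first by split; rewrite ?(inj_eq val_inj).
split; rewrite -?card_nbhd //.
- move=> r r0 rx ry xr yr.
  have : r \in val @: nbhd x by rewrite val_nbhd inE r0 rx xr eqxx.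
  case/imsetP => v vx rv; have := in_set0 v.
  rewrite -NI inE vx inE /= /zd_adj -rv yr.
  by rewrite eqxx -(inj_eq val_inj) -rv eq_sym ry.
- move=> r r0 zr; have vr : nonzero_zero_divisor r by apply/andP.
  have := in_setT (Sub r vr : ZDG); rewrite -NU !inE /= /zd_adj SubK.
  by case/orP => /andP[_ /eqP]; [left | right].
Qed.

Lemma double_star_pair_edge a b : double_star_pair a b ->
  exists x y : ZDG, double_star_edge x y.
Proof.
case=> [[a0 b0 ab ab0] [Na Nb notboth either]].
have za : nonzero_zero_divisor a.
  by rewrite /nonzero_zero_divisor a0; apply/existsP; exists b; rewrite b0 ab0 eqxx.
have zb : nonzero_zero_divisor b.
  rewrite /nonzero_zero_divisor b0; apply/existsP; exists a.
  by rewrite a0 mulrC ab0 eqxx.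
pose x : ZDG := Sub a za; pose y : ZDG := Sub b zb.
have vx : val x = a by rewrite SubK.
have vy : val y = b by rewrite SubK.
have xy : x != y by rewrite -(inj_eq val_inj) vx vy.
have adjxy : adj x y by rewrite /= /zd_adj xy vx vy ab0 eqxx.
exists x, y; rewrite /double_star_edge !card_nbhd vx vy Na Nb adjxy /=.
apply/andP; split.
  rewrite -subset0; apply/subsetP => v; rewrite !inE /= /zd_adj vx vy.
  case/andP => /andP[xv /eqP av] /andP[yv /eqP bv]; exfalso.
  have /andP[v0 _] := valP v.
  by apply: (notboth (val v)); rewrite // -?vx -?vy (inj_eq val_inj) eq_sym.
rewrite -subTset; apply/subsetP => v _; rewrite !inE.
(* The ends [x] and [y] are treated apart, since for them [either] might only provide a vanishing
   square, which is no edge. *)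
have [->|vx'] := eqVneq v x; first by rewrite [adj y x]adj_sym adjxy orbT.
have [->|vy'] := eqVneq v y; first by rewrite adjxy.
have /andP[v0 zv] := valP v; rewrite /= /zd_adj vx vy ![_ == v]eq_sym vx' vy' /=.
by case: (either _ v0 zv) => ->; rewrite eqxx ?orbT.
Qed.

(** The pair comes from the idempotents [(1, 0)] and [(0, 1)]. Their annihilators are the two
    coordinate axes, each with three nonzero points. *)
Lemma F4F4_double_star_pair (K : finFieldType) :
  #|K| = 4%N -> ring_isomorphic R (K * K)%type ->
  exists a b, double_star_pair a b.
Proof.
move=> K4 [f [h hK fK]].
have fI : injective f := can_inj hK.
have card_pre (B : {set K * K}) : #|f @^-1: B| = #|B|.
  by apply: on_card_preimset; apply: onW_bij; exists h.
pose a := h (1, 0); pose b := h (0, 1).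
have fa : f a = (1, 0) by rewrite fK.
have fb : f b = (0, 1) by rewrite fK.
have f_eq0 r : (r == 0) = ((f r).1 == 0) && ((f r).2 == 0).
  by rewrite -(inj_eq fI) rmorph0 -pair_eqE.
have aE r : (a * r == 0) = ((f r).1 == 0).
  by rewrite f_eq0 rmorphM fa /= mul1r mul0r eqxx andbT.
have bE r : (b * r == 0) = ((f r).2 == 0).
  by rewrite f_eq0 rmorphM fb /= mul1r mul0r eqxx.
exists a, b; split; split.
- by rewrite f_eq0 fa /= oner_eq0.
- by rewrite f_eq0 fb /= oner_eq0 andbF.
- by rewrite -(inj_eq fI) fa fb -pair_eqE /= oner_eq0.
- by apply/eqP; rewrite aE fb.
- transitivity #|[set (0 : K, t) | t in [set~ (0 : K)]]|; last first.
    by rewrite card_imset ?cardsC1 ?K4 // => s t [].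
  rewrite -card_pre; apply: eq_card => r; rewrite !inE aE f_eq0 -(inj_eq fI) fa.
  case: (f r) => s t /=; rewrite -pair_eqE /=.
  apply/idP/imsetP => [/and3P[st _ /eqP s0]|[t' t0 [-> ->]]].
    by exists t; rewrite ?s0 // !inE; move: st; rewrite s0 eqxx.
  by move: t0; rewrite !inE eqxx => -> /=; rewrite eq_sym oner_eq0.
- transitivity #|[set (t, 0 : K) | t in [set~ (0 : K)]]|; last first.
    by rewrite card_imset ?cardsC1 ?K4 // => s t [].
  rewrite -card_pre; apply: eq_card => r; rewrite !inE bE f_eq0 -(inj_eq fI) fb.
  case: (f r) => s t /=; rewrite -pair_eqE /=.
  apply/idP/imsetP => [/and3P[st _ /eqP s0]|[t' t0 [-> ->]]].
    by exists s; rewrite ?s0 // !inE; move: st; rewrite s0 eqxx andbT.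
  move: t0; rewrite !inE eqxx andbT => -> /=.
  by rewrite [0 == 1]eq_sym oner_eq0 andbF.
- by move=> r r0 _ _ /eqP + /eqP; rewrite aE bE => s0 t0; rewrite f_eq0 s0 t0 in r0.
(* Where the witness [y] has a nonzero coordinate, [r] has a zero one, because [K] is a field. *)
- move=> r r0 /existsP[y /andP[y0]]; rewrite f_eq0 rmorphM /= !mulf_eq0.
  move: y0; rewrite f_eq0 negb_and -(aE r) -(bE r).
  by case/orP => /negPf->; rewrite orbF => /andP[/eqP ? /eqP ?]; [left | right].
Qed.

End ZeroDivisors.

Theorem theorem3p21 (R : finComNzRingType) :
  gamma_a (zero_divisor_graph R) = 2 ->
  (gda_partitionable (zero_divisor_graph R) <->
   psi_g (zero_divisor_graph R) = 2 \/ ring_isomorphic R (F4 * F4)%type).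
Proof.
move=> gam2; split=> [|[psi2|isoR]].
- rewrite /gda_partitionable leq_eqVlt => /predU1P[<-|psi3]; [by left | right].
  have [x [y /double_star_edge_pair]] := large_psi_g_double_star_edge gam2 psi3.
  exact: double_star_pair_F4F4 card_F4.
- by rewrite /gda_partitionable psi2.
(* A partition into two alliances is enough here: the edge of the two idempotents and its
   complement. *)
- have [a [b /double_star_pair_edge[x [y]]]] := F4F4_double_star_pair card_F4 isoR.
  exact: double_star_edge_partitionable.
Qed.
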